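(* Let $F$ be a near-idempotent tract, let $J$ be an M-convex set on $[n]$, let $\kappa\in\mathbb{Z}_{\ge0}^n$, and let $f$ be a (strong Grassmann–Plücker) representation of $J$ over $F$, viewed as a generating function with coefficients in $F$. Let $\tau$ be a section-defining vector for $\mathrm{proj}_\kappa\colon J^{\max_\kappa}\to\mathrm{Ret}_\kappa(J)$. Then $\mathrm{Ret}_\kappa^\tau(f)$ is a representation of $\mathrm{Ret}_\kappa(J)$ over $F$.
   Context: Let $[n]=\{1,\dots,n\}$, $\Delta_n^r=\{\alpha\in\mathbb{Z}_{\ge0}^n:\alpha_1+\cdots+\alpha_n=r\}$, and order $\mathbb{Z}^n$ coordinatewise. A nonempty $J\subseteq\Delta_n^r$ is M-convex (of rank $r$) if for all $\alpha,\beta\in J$ and $i$ with $\alpha_i<\beta_i$ there is $j$ with $\alpha_j>\beta_j$ and $\alpha+e_i-e_j,\ \beta-e_i+e_j\in J$. Put $(\delta_J^+)_i=\max\{\alpha_i:\alpha\in J\}$ and $(\delta_J^-)_i=\min\{\alpha_i:\alpha\in J\}$. A tract is a pair $(F,N_F)$: $F$ is a commutative monoid with zero such that $F^\times=F\setminus\{0\}$ is an abelian group, and $N_F$ (the null set) is an ideal of the semiring $\mathbb{N}[F^\times]$ of finite formal sums of elements of $F^\times$ (with $0\in F$ identified with the empty sum), such that for every $a\in F$ there is a unique $b\in F$, denoted $-a$, with $a+b\in N_F$. It is near-idempotent if $1=-1$ and there is $x\in F^\times$ with $1+1+x\in N_F$. A strong Grassmann–Plücker representation of $J\subseteq\Delta_n^r$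 over $F$ is a map $\rho\colon\Delta_n^r\to F$ such that (1) $\rho(\alpha)\in F^\times\iff\alpha\in J$; (2) for every $2\le s\le r$, every $\alpha\in\Delta_n^{r-s}$ and all $i_0,\dots,i_s,j_2,\dots,j_s\in[n]$ with $\delta_J^-\le\alpha$ and $\alpha+e_{i_0}+\cdots+e_{i_s}+e_{j_2}+\cdots+e_{j_s}\le\delta_J^+$, $$\sum_{k=0}^s\rho(\alpha+e_{i_0}+\cdots+\widehat{e_{i_k}}+\cdots+e_{i_s})\,\rho(\alpha+e_{i_k}+e_{j_2}+\cdots+e_{j_s})\in N_F,$$ where the hat means omission. A representation $\rho$ is identified with the formal generating function $f=\sum_{\alpha\in J}\rho(\alpha)\frac{w^\alpha}{\alpha!}$ (division by $\alpha!=\prod_i\alpha_i!$ is purely formal); conversely a generating function with M-convex support is a representation of its support if its coefficient function (extended by $0$) is a strong Grassmann–Plücker representation. $\mathrm{proj}_\kappa(v)_i=\min(v_i,\kappa_i)$; $J^{\max_\kappa}$ is the set of $\alpha\in J$ with $\mathrm{proj}_\kappa(\alpha)$ coordinatewise maximal in $\mathrm{proj}_\kappa(J)$; $\mathrm{Ret}_\kappa(J)=\mathrm{proj}_\kappa(J^{\max_\kappa})$, an M-convex set. A vector $\tau$ is section-defining if $\tau=\alpha-\mathrm{proj}_\kappa(\alpha)$ for some $\alpha\in J^{\max_\kappa}$; then $x+\tau\in J^{\max_\kappa}$ and $\mathrm{proj}_\kappa(x+\tau)=x$ for all $x\in\mathrm{Ret}_\kappa(J)$. For $f=\sum_{\alpha\in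 J}\rho(\alpha)\frac{w^\alpha}{\alpha!}$, $\mathrm{Ret}_\kappa^\tau(f)=\sum_{x\in\mathrm{Ret}_\kappa(J)}\rho(x+\tau)\frac{w^x}{x!}$. *)

(* Defs.v *)
From HB Require Import structures.
From mathcomp Require Import all_boot finmap multiset.
From mathcomp Require Import ssralg mpoly.

Set Implicit Arguments.
Unset Strict Implicit.
Unset Printing Implicit Defensive.

Local Open Scope fset_scope.
Local Open Scope mset_scope.

(* Commutative monoids with zero whose nonzero elements form a group; the
   closure of the nonzero elements under product follows from the axioms. *)
HB.mixin Record Monoid_isComGroupWithZero F of Monoid F := {
  zero : F;
  mulC : @commutative F F *%g;
  mul0 : @left_zero F F zero *%g;
  one_neq_zero : (1%g : F) != zero;
  unitP : forall x : F, x != zero -> exists y : F, (x * y)%g = 1%g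
}.

#[short(type="comGroupWithZeroType")]
HB.structure Definition ComGroupWithZero :=
  {F of Monoid F & Monoid_isComGroupWithZero F}.

Section FormalSums.
Variable F : comGroupWithZeroType.

(* The elements of the semiring N[F^x] are encoded as the multisets on F that
   do not contain zero; its product is fmul below. *)
Definition formal_sum (A : {mset F}) : bool := (zero : F) \notin A.

(* The formal sum of a sequence of elements of F, with zero read as the empty
   sum. *)
Definition fsum (s : seq F) : {mset F} := seq_mset [seq x <- s | x != zero].

Definition fmul (A B : {mset F}) : {mset F} :=
  seq_mset [seq (x * y)%g | x <- A, y <- B].

Definition formal_ideal (N : {mset F} -> Prop) : Prop :=
  [/\ forall A, N A -> formal_sum A,
      N mset0,
      forall A B, N A -> N B -> N (A `+` B) &
      forall A B, formal_sum A -> N B -> N (fmul A B)].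

End FormalSums.

HB.mixin Record ComGroupWithZero_isTract F of ComGroupWithZero F := {
  null : {mset F} -> Prop;
  null_ideal : @formal_ideal F null;
  opp : F -> F;
  null_opp : forall a : F, null (@fsum F [:: a; opp a]);
  null_uniq : forall a b : F, null (@fsum F [:: a; b]) -> b = opp a
}.

#[short(type="tractType")]
HB.structure Definition Tract :=
  {F of ComGroupWithZero F & ComGroupWithZero_isTract F}.

Definition near_idempotent (F : tractType) : Prop :=
  (1%g : F) = opp (1%g : F) /\
  exists2 x : F, x != zero & null (fsum [:: 1%g; 1%g; x]).

(* Vectors with nonnegative integer coordinates are multinomials: mdeg is the
   sum of the coordinates, U_(i) is the i-th unit vector, and (_ <= _)%MM is the
   coordinatewise order (unlike (_ <= _)%O, which is a monomial order). *)

Definition M_convex_rank n (r : nat) (J : {fset 'X_{1..n}}) : Prop :=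
  [/\ J != fset0,
      forall a, a \in J -> mdeg a = r &
      forall a b, a \in J -> b \in J -> forall i : 'I_n, a i < b i ->
        exists j : 'I_n,
          [/\ b j < a j, (a + U_(i) - U_(j))%MM \in J &
              (b - U_(i) + U_(j))%MM \in J]].

Definition M_convex n (J : {fset 'X_{1..n}}) : Prop :=
  exists r, M_convex_rank r J.

Definition delta_max n (J : {fset 'X_{1..n}}) : 'X_{1..n} :=
  [multinom \max_(a <- J) a i | i < n].

(* The maximum serves as the neutral element of the iterated minimum, which is
   thus the minimum over J whenever J is nonempty. *)
Definition delta_min n (J : {fset 'X_{1..n}}) : 'X_{1..n} :=
  [multinom \big[minn/delta_max J i]_(a <- J) a i | i < n].

(* The map rho is only evaluated on vectors of degree r. The indices i_0..i_s
   and j_2..j_s are given by i : 'I_s.+1 -> 'I_n and j : 'I_s.-1 -> 'I_n. *)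
Definition strong_GP (F : tractType) n (r : nat) (J : {fset 'X_{1..n}})
    (rho : 'X_{1..n} -> F) : Prop :=
  (forall a, mdeg a = r -> (rho a != zero) = (a \in J)) /\
  (forall s, 2 <= s <= r ->
   forall a : 'X_{1..n}, mdeg a = r - s ->
   forall (i : 'I_s.+1 -> 'I_n) (j : 'I_s.-1 -> 'I_n),
     (delta_min J <= a)%MM ->
     (a + \sum_(k < s.+1) U_(i k) + \sum_(l < s.-1) U_(j l)
        <= delta_max J)%MM ->
     null (fsum [seq (rho (a + \sum_(l < s.+1 | l != k) U_(i l))%MM
                      * rho (a + U_(i k) + \sum_(l < s.-1) U_(j l))%MM)%g
                | k : 'I_s.+1])).

(* f stands for the formal sum of the f a * w^a / a! over a in finsupp f. *)
Definition genfun (F : tractType) n := {fsfun 'X_{1..n} -> F with zero}.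

Definition representation (F : tractType) n (J : {fset 'X_{1..n}})
    (f : genfun F n) : Prop :=
  finsupp f = J /\ exists2 r, M_convex_rank r J & strong_GP r J f.

Definition proj n (kappa v : 'X_{1..n}) : 'X_{1..n} :=
  [multinom minn (v i) (kappa i) | i < n].

Definition proj_max n (kappa : 'X_{1..n}) (J : {fset 'X_{1..n}}) :
    {fset 'X_{1..n}} :=
  [fset a in J | [forall v : [fset proj kappa b | b in J],
     (proj kappa a <= val v)%MM ==> (val v == proj kappa a)]].

Definition Ret n (kappa : 'X_{1..n}) (J : {fset 'X_{1..n}}) :
    {fset 'X_{1..n}} :=
  [fset proj kappa a | a in proj_max kappa J].

Definition section_defining n (kappa : 'X_{1..n}) (J : {fset 'X_{1..n}})
    (tau : 'X_{1..n}) : Prop :=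
  exists2 a, a \in proj_max kappa J & tau = (a - proj kappa a)%MM.

Fact Ret_genfun_key : unit. Proof. exact: tt. Qed.
Definition Ret_genfun (F : tractType) n (kappa tau : 'X_{1..n})
    (f : genfun F n) : genfun F n :=
  [fsfun[Ret_genfun_key] x in Ret kappa (finsupp f) => f (x + tau)%MM].

(* Main.v *)
Require Import Defs.
From mathcomp Require Import all_boot finmap multiset.
From mathcomp Require Import ssralg mpoly.
From mathcomp Require Import zify.

Set Implicit Arguments.
Unset Strict Implicit.
Unset Printing Implicit Defensive.

(** Write [|v|] for the degree [mdeg v].

    The key point is that, although [Ret kappa J] is defined as an image, its
    translate by [tau] is the intersection of [J] with a box:
    [Ret kappa J + tau] is the set of the elements of [J] between [tau] and
    [kappa + tau] ([mem_Ret]).  Everything follows from this description.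
    Exchanges between two elements of a box never leave the box, so [Ret kappa J] is
    M-convex ([M_convex_box]).  The coefficient of the retraction at [x <= kappa]
    is the coefficient of [f] at [x + tau], so that a Grassmann-Pluecker relation
    of the retraction at [alpha] is, term by term, the relation of [f] at
    [alpha + tau]; this one is available because the translates by [tau] of the
    bounds of [Ret kappa J] lie within the bounds of [J].

    The description rests on two exchange arguments.  An exchange step at [i]
    and [j] changes [proj kappa a] in a simple way ([proj_exchange]): coordinate
    [i] grows unless [a] has already reached [kappa] there, and coordinate [j]
    drops unless [a] exceeds [kappa] there.  Stepping from an element [b] with
    larger [|proj kappa b|] towards a coordinatewise maximal [a] shows that
    there is no such [b]: coordinatewise maximality of the projection amounts
    to maximality of its degree ([proj_max_mdeg]).  Stepping from one element [a]
    of maximal degree towards another one, [b], moves [proj kappa a] to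
    [proj kappa b] without changing [a - proj kappa a]: this is the section
    property ([proj_max_section]). *)

(** * Exchange steps and projections *)

(** An exchange step at [i] and [j] only affects these two coordinates, so that
    comparing [k] with both reduces a coordinatewise claim to linear arithmetic. *)
Ltac exchange_lia i j k :=
  rewrite !(mnmDE, mnmBE, mnm1E);
  case: (eqVneq i k) (eqVneq j k) => [?|_] [?|_] /=; subst; lia.

Section Exchange.
Variables (n : nat) (kappa : 'X_{1..n}).
Implicit Types (a b x y tau : 'X_{1..n}) (i j : 'I_n) (J : {fset 'X_{1..n}}).

Lemma proj_le a : (proj kappa a <= a)%MM.
Proof. by apply/mnm_lepP => k; rewrite mnmE geq_minl. Qed.

Lemma proj_le_bound a : (proj kappa a <= kappa)%MM.
Proof. by apply/mnm_lepP => k; rewrite mnmE geq_minr. Qed.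

Lemma lem_mdeg_eq x y : (x <= y)%MM -> mdeg y <= mdeg x -> x = y.
Proof.
move=> le_xy; rewrite -(submK le_xy) mdegD -{2}[mdeg x]add0n leq_add2r leqn0.
by rewrite mdeg_eq0 => /eqP->; rewrite add0m.
Qed.

Lemma mdeg_lt_exists x y : mdeg x <= mdeg y -> x <> y -> exists i, x i < y i.
Proof.
move=> le_xy neq_xy; apply/existsP/negP => /pred0P xy; apply/neq_xy/esym.
apply: lem_mdeg_eq le_xy.
by apply/mnm_lepP => k; rewrite leqNgt; have /= -> := xy k.
Qed.

(** Exchanging towards [y] makes progress, measured by [mdeg (x - y)]. *)
Lemma exchange_sub x y i j : y i < x i -> x j < y j ->
  (x - y = x - U_(i) + U_(j) - y + U_(i))%MM.
Proof. by move=> lt_i lt_j; apply/mnmP => k; exchange_lia i j k. Qed.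

Lemma exchangeC x i j : 0 < x i -> (x - U_(i) + U_(j) = x + U_(j) - U_(i))%MM.
Proof. by move=> x_gt0; apply/mnmP => k; exchange_lia i j k. Qed.

Lemma proj_exchange a i j : i != j -> 0 < a j ->
  (proj kappa (a + U_(i) - U_(j)) + U_(j) *+ (a j <= kappa j)
   = proj kappa a + U_(i) *+ (a i < kappa i))%MM.
Proof.
move=> neq_ij a_gt0; apply/mnmP => k.
rewrite !(mnmDE, mulmnE, mnmE, mnmBE, mnm1E).
by case: (eqVneq i k) (eqVneq j k) neq_ij => [->|_] [?|_] //=; subst; lia.
Qed.

Lemma mdeg_proj_exchange a i j : i != j -> 0 < a j ->
  mdeg (proj kappa (a + U_(i) - U_(j))) + (a j <= kappa j)
  = mdeg (proj kappa a) + (a i < kappa i).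
Proof.
move=> neq_ij /(proj_exchange neq_ij) /(congr1 mdeg).
by rewrite !mdegD !mdegMn !mdeg1 !mul1n.
Qed.

Lemma mem_proj_max J a :
  reflect (a \in J /\ forall b, b \in J ->
             (proj kappa a <= proj kappa b)%MM -> proj kappa b = proj kappa a)
          (a \in proj_max kappa J).
Proof.
rewrite !inE /=; apply: (iffP andP) => [] [aJ] => [/forallP amax | amax].
  split=> // b bJ le_ab.
  have pbJ : proj kappa b \in [fset proj kappa c | c in J]%fset by apply: in_imfset.
  by apply/eqP; have /implyP := amax [` pbJ]%fset; apply.
split=> //; apply/forallP => - [v /= vJ]; apply/implyP.
by case/imfsetP: vJ => b bJ -> /= /(amax b bJ) ->.
Qed.

(** * Maximal projections of an M-convex set *)

(** If [b] had a larger projection, exchange [b] towards [a]: the step on [a]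
    raises coordinate [i] of its projection, so by maximality it must lower
    coordinate [j]; hence the step on [b], at the same [i] and [j], raises
    coordinate [j] of the projection of [b], which stays at least as large while
    [b] comes closer to [a]. *)
Lemma proj_max_leq r J a b : M_convex_rank r J -> a \in proj_max kappa J ->
  b \in J -> mdeg (proj kappa b) <= mdeg (proj kappa a).
Proof.
case=> _ _ exJ /mem_proj_max[aJ amax].
(* Induction on the excess of [b] over [a], of which each step removes one. *)
have [m] := ubnP (mdeg (b - a)%MM).
elim: m b => // m IHm b le_m bJ; rewrite leqNgt; apply/negP => lt_ab.
have [i] : exists i, proj kappa a i < proj kappa b i.
  by apply: mdeg_lt_exists; [exact: ltnW | move=> eq_ab; rewrite eq_ab ltnn in lt_ab].
rewrite !mnmE => lt_i; have lt_abi : a i < b i by lia.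
have lt_ai : a i < kappa i by lia.
have [j [lt_baj a'J b'J]] := exJ a b aJ bJ i lt_abi.
have neq_ij : i != j by apply: contraTneq lt_baj => <-; rewrite -leqNgt ltnW.
have le_aj : a j <= kappa j.
  rewrite leqNgt; apply/negP => gt_aj.
  have := proj_exchange neq_ij (leq_ltn_trans (leq0n _) lt_baj).
  rewrite lt_ai leqNgt gt_aj mulm0n mulm1n addm0 => eq_a'.
  have := amax _ a'J; rewrite eq_a' => /(_ (lem_addr _ _)).
  by move/(congr1 mdeg); rewrite mdegD mdeg1; lia.
have b_gt0 : 0 < b i by lia.
have := IHm _ _ b'J; rewrite (exchange_sub lt_abi lt_baj) mdegD mdeg1 in le_m.
move=> /(_ ltac:(lia)); rewrite exchangeC //.
(* [b] steps in the direction opposite to [a]: it gains at [j], loses at [i]. *)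
have := mdeg_proj_exchange (i := j) (j := i) _ b_gt0.
rewrite eq_sym => /(_ neq_ij); lia.
Qed.

Lemma proj_max_mdeg r J a b : M_convex_rank r J -> a \in proj_max kappa J ->
  b \in J -> mdeg (proj kappa a) <= mdeg (proj kappa b) ->
  b \in proj_max kappa J.
Proof.
move=> convJ amax bJ le_ab; apply/mem_proj_max; split=> // c cJ le_bc.
apply/esym/lem_mdeg_eq => //.
exact: leq_trans (proj_max_leq convJ amax cJ) le_ab.
Qed.

(** Exchange [a] towards [b], at a coordinate [i] where its projection is too
    small. Maximality forces the step to lower the projection at the other
    coordinate [j], so that [a] and its projection change by the same vector. *)
Lemma proj_max_section r J a b : M_convex_rank r J ->
  a \in proj_max kappa J -> b \in proj_max kappa J ->
  (proj kappa b + (a - proj kappa a))%MM \in J.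
Proof.
move=> convJ + bmax; have [_ _ exJ] := convJ.
have [bJ _] := mem_proj_max _ _ bmax.
have [m] := ubnP (mdeg (proj kappa a - proj kappa b)%MM).
elim: m a => // m IHm a le_m amax; have [aJ _] := mem_proj_max _ _ amax.
have [-> | neq_ab] := eqVneq (proj kappa b) (proj kappa a).
  by rewrite addmC submK // proj_le.
have [i lt_pi] : exists i, proj kappa a i < proj kappa b i.
  apply: mdeg_lt_exists; first exact: proj_max_leq convJ bmax aJ.
  by move/eqP; rewrite eq_sym (negPf neq_ab).
have [lt_abi lt_ai] : a i < b i /\ a i < kappa i by move: lt_pi; rewrite !mnmE; lia.
have [j [lt_baj a'J _]] := exJ a b aJ bJ i lt_abi.
have neq_ij : i != j by apply: contraTneq lt_baj => <-; rewrite -leqNgt ltnW.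
have a_gt0 : 0 < a j by lia.
have deg_a' := mdeg_proj_exchange neq_ij a_gt0.
have le_a' := proj_max_leq convJ amax a'J.
(* Otherwise [deg_a'] would contradict the maximality stated by [le_a']. *)
have le_aj : a j <= kappa j by lia.
have a'max : (a + U_(i) - U_(j))%MM \in proj_max kappa J.
  by apply: proj_max_mdeg convJ amax a'J _; lia.
have lt_pj : proj kappa b j < proj kappa a j by rewrite !mnmE; lia.
have p_gt0 : 0 < proj kappa a j by lia.
have := proj_exchange neq_ij a_gt0; rewrite lt_ai le_aj !mulm1n.
move/(congr1 (fun x => (x - U_(j))%MM)); rewrite addmK => eq_p.
have := IHm _ _ a'max; rewrite eq_p.
rewrite (exchange_sub lt_pj lt_pi) mdegD mdeg1 exchangeC // in le_m.
move=> /(_ ltac:(lia)); congr (_ \in J); congr (_ + _)%MM.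
by apply/mnmP => k; exchange_lia i j k.
Qed.

(** * The retraction as a translated box *)

(** The section property puts [Ret kappa J + tau] in the box. Conversely, if
    [x + tau] is in [J] and in the box, then [x <= proj kappa (x + tau)], and both
    sides have the same degree since that of [x] is already maximal. *)
Lemma mem_Ret r J tau x : M_convex_rank r J -> section_defining kappa J tau ->
  (x \in Ret kappa J) = (x <= kappa)%MM && ((x + tau)%MM \in J).
Proof.
move=> convJ [a amax ->]; have [_ degJ _] := convJ.
have [aJ _] := mem_proj_max _ _ amax.
apply/imfsetP/andP => [[b /= bmax ->] | [le_x xJ]].
  by rewrite proj_le_bound (proj_max_section convJ amax).
(* Both [a] and [x + tau] have degree [r], and [tau = a - proj kappa a]. *)
have deg_x : mdeg x = mdeg (proj kappa a).
  have := degJ _ xJ; have := degJ _ aJ; rewrite -{1}(submK (proj_le a)) !mdegD.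
  lia.
have le_px : (x <= proj kappa (x + (a - proj kappa a)))%MM.
  apply/mnm_lepP => k; move/mnm_lepP/(_ k): le_x; rewrite !mnmE; lia.
have eq_x : x = proj kappa (x + (a - proj kappa a)).
  by apply: lem_mdeg_eq => //; rewrite deg_x (proj_max_leq convJ amax xJ).
exists (x + (a - proj kappa a))%MM => //=.
by apply: proj_max_mdeg convJ amax xJ _; rewrite -eq_x deg_x.
Qed.

(** An exchange between two elements moves each coordinate of one towards the
    same coordinate of the other, so it preserves all bounds on coordinates. *)
Lemma M_convex_box r J J' tau : M_convex_rank r J -> J' != fset0%fset ->
  (forall x, (x \in J') = (x <= kappa)%MM && ((x + tau)%MM \in J)) ->
  M_convex_rank (r - mdeg tau) J'.
Proof.
case=> _ degJ exJ J'0 memJ'; split=> // [x | x y].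
  by rewrite memJ' => /andP[_ /degJ <-]; rewrite mdegD addnK.
rewrite !memJ' => /andP[/mnm_lepP le_x xJ] /andP[/mnm_lepP le_y yJ] i lt_i.
have [|j []] := exJ _ _ xJ yJ i; first by rewrite !mnmDE ltn_add2r.
rewrite !mnmDE ltn_add2r => lt_j x'J y'J; exists j.
rewrite !memJ'; split=> //; apply/andP; split.
- by apply/mnm_lepP => k; move: (le_x k) (le_y k); exchange_lia i j k.
- by congr (_ \in J): x'J; apply/mnmP => k; exchange_lia i j k.
- by apply/mnm_lepP => k; move: (le_x k) (le_y k); exchange_lia i j k.
- by congr (_ \in J): y'J; apply/mnmP => k; exchange_lia i j k.
Qed.

End Exchange.

(** * Translating Grassmann-Pluecker relations *)

Lemma leq_delta_max n (J : {fset 'X_{1..n}}) a i :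
  a \in J -> a i <= delta_max J i.
Proof.
by move=> aJ; rewrite mnmE (@leq_bigmax_seq _ _ xpredT (fun a : 'X_{1..n} => a i)).
Qed.

Lemma delta_min_leq n (J : {fset 'X_{1..n}}) a i :
  a \in J -> delta_min J i <= a i.
Proof.
rewrite mnmE => aJ; have : a \in (J : seq _) by [].
elim: (J : seq _) => // b s IHs; rewrite inE big_cons => /predU1P[<- | /IHs].
  exact: geq_minl.
exact: leq_trans (geq_minr _ _).
Qed.

Lemma lepm_add2r n (z x y : 'X_{1..n}) : (x <= y)%MM -> (x + z <= y + z)%MM.
Proof. by move/mnm_lepP => le_xy; apply/mnm_lepP => k; rewrite !mnmDE leq_add2r. Qed.

Section Translate.
Variables (n : nat) (J J' : {fset 'X_{1..n}}) (tau : 'X_{1..n}).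
Hypothesis J'0 : J' != fset0%fset.
Hypothesis subJ : forall x, x \in J' -> (x + tau)%MM \in J.

Lemma delta_max_translate : (delta_max J' + tau <= delta_max J)%MM.
Proof.
have [x0 x0J'] := fset0Pn _ J'0; apply/mnm_lepP => i; rewrite mnmDE.
have := leq_delta_max i (subJ x0J'); rewrite mnmDE => le_tau.
suff : delta_max J' i <= delta_max J i - tau i by lia.
rewrite [delta_max J' i]mnmE; apply/bigmax_leqP_seq => x xJ' _.
by have := leq_delta_max i (subJ xJ'); rewrite mnmDE; lia.
Qed.

Lemma delta_min_translate : (delta_min J <= delta_min J' + tau)%MM.
Proof.
have [x0 x0J'] := fset0Pn _ J'0; apply/mnm_lepP => i; rewrite mnmDE -leq_subLR.
suff : delta_min J i - tau i <= delta_min J' i by lia.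
rewrite [delta_min J' i]mnmE big_seq.
apply: (big_ind (leq (delta_min J i - tau i))) => [|k l lek lel|x xJ'].
(* The neutral element of the iterated minimum is the maximum over [J'], which
   is at least the coordinate of [x0]. *)
- have := delta_min_leq i (subJ x0J'); have := leq_delta_max i x0J'.
  by rewrite mnmDE; lia.
- by rewrite leq_min lek.
- by have := delta_min_leq i (subJ xJ'); rewrite mnmDE; lia.
Qed.

(** The arguments of [rho'] in a relation of [J'] at [a] are at most
    [delta_max J'], so translating them by [tau] turns this relation into the one
    of [J] at [a + tau], whose own bounds follow from [delta_min_translate] and
    [delta_max_translate]. *)
Lemma strong_GP_translate (F : tractType) r (rho rho' : 'X_{1..n} -> F) :
  (forall x, (rho' x != zero) = (x \in J')) ->
  (forall x, (x <= delta_max J')%MM -> rho' x = rho (x + tau)%MM) ->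
  strong_GP r J rho -> strong_GP (r - mdeg tau) J' rho'.
Proof.
move=> supp' rho'E [_ GP]; split=> [a _|]; first exact: supp'.
move=> s /andP[s_ge2 le_sr] a deg_a i j le_a ge_a.
have := GP s _ (a + tau)%MM _ i j; rewrite s_ge2 mdegD deg_a.
move=> /(_ ltac:(lia) ltac:(lia)).
have shift x y : (x + tau + y = x + y + tau)%MM.
  by rewrite -!addmA [(tau + y)%MM]addmC.
have sumD1 k : (\sum_(l < s.+1) U_(i l)
                = U_(i k) + \sum_(l < s.+1 | l != k) U_(i l))%MM.
  by rewrite (bigD1 k).
have le_first k : (a + \sum_(l < s.+1 | l != k) U_(i l) <= delta_max J')%MM.
  apply: lepm_trans ge_a; apply/mnm_lepP => m.
  by rewrite (sumD1 k) !mnmDE; lia.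
have le_second k : (a + U_(i k) + \sum_(l < s.-1) U_(j l) <= delta_max J')%MM.
  apply: lepm_trans ge_a; apply/mnm_lepP => m.
  by rewrite (sumD1 k) !mnmDE; lia.
rewrite !shift => {}GP.
rewrite (_ : [seq _ | k : 'I_s.+1] =
  [seq (rho (a + tau + \sum_(l < s.+1 | l != k) U_(i l))%MM
        * rho (a + tau + U_(i k) + \sum_(l < s.-1) U_(j l))%MM)%g
  | k : 'I_s.+1]).
  apply: GP.
    exact: lepm_trans delta_min_translate (lepm_add2r tau le_a).
  exact: lepm_trans (lepm_add2r tau ge_a) delta_max_translate.
by apply: eq_image => // k; rewrite !rho'E // !shift.
Qed.

End Translate.

Theorem corollary7p4 (F : tractType) (n : nat) (J : {fset 'X_{1..n}})
    (kappa tau : 'X_{1..n}) (f : genfun F n) :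
  near_idempotent F ->
  M_convex J ->
  representation J f ->
  section_defining kappa J tau ->
  representation (Ret kappa J) (Ret_genfun kappa tau f).
Proof.
move=> _ _ [suppf [r convJ GPf]] tauP.
have memRet x := mem_Ret x convJ tauP.
have subJ x : x \in Ret kappa J -> (x + tau)%MM \in J.
  by rewrite memRet => /andP[].
have fE x : (x <= kappa)%MM -> Ret_genfun kappa tau f x = f (x + tau)%MM.
  move=> le_x; rewrite fsfunE suppf memRet le_x /=.
  by case: ifPn => //; rewrite -suppf => /fsfun_dflt->.
have f_neq0 x : (Ret_genfun kappa tau f x != zero) = (x \in Ret kappa J).
  rewrite fsfunE suppf; case: ifP => [/subJ|]; last by rewrite eqxx.
  by rewrite -suppf mem_finsupp.
have Ret0 : Ret kappa J != fset0%fset.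
  have [a amax _] := tauP; apply: (introT (fset0Pn _)).
  by exists (proj kappa a); rewrite in_imfset.
split; first by apply/fsetP => x; rewrite mem_finsupp f_neq0.
exists (r - mdeg tau); first exact: M_convex_box convJ Ret0 memRet.
have le_max : (delta_max (Ret kappa J) <= kappa)%MM.
  apply/mnm_lepP => k; rewrite mnmE; apply/bigmax_leqP_seq => x.
  by rewrite memRet => /andP[/mnm_lepP].
have fE_max x (le_x : (x <= delta_max (Ret kappa J))%MM) :=
  fE x (lepm_trans le_x le_max).
exact (strong_GP_translate Ret0 subJ f_neq0 fE_max GPf).
Qed.
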